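(* Let $R$ be a finite Frobenius ring with generating character $\chi$, let $V=R^n$, let $g\ge 1$ be an integer, and let $G$ be a finite permutation group acting on the coordinates of $V$. Let $H$ be a subgroup of $G$ such that $|H|$ has an inverse in $R$. If $C$ is a left $G$-code of length $n$ over $R$, then $$\mathbf{cwe}_H^{(g)}\bigl(((C^{\perp})\theta_H)M_H : \{x_a\}_{a\in R^g}\bigr) = \frac{1}{|C\theta_H|^{g}}\,\mathbf{cwe}_H^{(g)}\Bigl(C\theta_H : \Bigl\{\sum_{b\in R^g}\chi\Bigl(\sum_{i=1}^{g}a_ib_i\Bigr)x_b\Bigr\}_{a\in R^g}\Bigr),$$ where $M_H$ is the $H$-orbit length matrix.
   Context: A finite (associative, unital) ring $R$ is Frobenius if $R/\mathrm{Rad}(R)\cong \mathrm{Soc}(R_R)$ as right $R$-modules and $R/\mathrm{Rad}(R)\cong\mathrm{Soc}({}_RR)$ as left $R$-modules. $R$ need not be commutative. Let $\widehat R$ be the group of homomorphisms from the additive group of $R$ to $\mathbb{C}^{*}$. A generating character of $R$ is a $\chi\in\widehat R$ that is right generating ($r\mapsto\chi^r$, $\chi^r(x)=\chi(rx)$, is an isomorphism of right $R$-modules $R\to\widehat R$) or left generating ($r\mapsto{}^r\chi$, ${}^r\chi(x)=\chi(xr)$, is an isomorphism of left $R$-modules $R\to\widehat R$); a finite ring is Frobenius if and only if it admits one. On $V=R^n$ put $(u,v):=u_1v_1+\cdots+u_nv_n$. A permutation group $G$ on $\{1,\dots,n\}$ acts on $V$ on the right by $(v\sigma)_i = v_{i\sigma^{-1}}$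 for $\sigma\in G$. A left $G$-code is a left $R$-submodule $C$ of $V$ with $C\sigma\subseteq C$ for all $\sigma\in G$; its right dual is $C^{\perp}:=\{u\in V:(v,u)=0\text{ for all }v\in C\}$. ''$|H|$ has an inverse in $R$'' means $|H|\cdot 1_R$ is a unit. Define $v\theta_H:=\frac1{|H|}\sum_{h\in H}vh$ for $v\in V$ and $X\theta_H:=\{v\theta_H:v\in X\}$. Let $H_V(\alpha_1),\dots,H_V(\alpha_t)$ be the orbits of $H$ on $\{1,\dots,n\}$, $m_i$ the cardinality of $H_V(\alpha_i)$, and $\overline{H_V(\alpha_i)}\in V$ the vector with entry $1$ at the positions in $H_V(\alpha_i)$ and $0$ elsewhere. Every $u\in V\theta_H$ is uniquely $u=\sum_{i=1}^t u_i\overline{H_V(\alpha_i)}$ with $u_i\in R$. The $H$-orbit length matrix is $M_H:=\mathrm{diag}(\ell_1,\dots,\ell_n)$ with $\ell_j=m_i$ if $j\in H_V(\alpha_i)$; $YM_H:=\{yM_H:y\in Y\}$ for $Y\subseteq V$. For a left or right $R$-submodule $D\subseteq V\theta_H$, the $g$-th $H$-complete weight enumerator is $\mathbf{cwe}_H^{(g)}(D:\{x_a\}_{a\in R^g}):=\sum_{u_1,\dots,u_g\in D}\prod_{a\in R^g}x_a^{n_a^H(u_1,\dots,u_g)}$, where, writing $u_k=\sum_{i=1}^t u_{k,i}\overline{H_V(\alpha_i)}$, $n_a^H(u_1,\dots,u_g)$ is the number of $i\in\{1,\dots,t\}$ with $(u_{1,i},\dots,u_{g,i})=a$. *)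

(* Defs.v *)
From HB Require Import structures.
From mathcomp Require Export all_boot all_order all_fingroup all_algebra.
From mathcomp Require Export mpoly complex reals.

Set Implicit Arguments.
Unset Strict Implicit.
Unset Printing Implicit Defensive.
Import Order.TTheory GRing.Theory Num.Theory.
Local Open Scope ring_scope.

Section Frobenius.
Variable R : finUnitRingType.

(* The two regular module structures are given by their scalar actions
   [op a x]: [lreg] is the left module R, [rreg] the right module R. *)
Definition lreg (a x : R) : R := a * x.
Definition rreg (a x : R) : R := x * a.

(* Closure under opposite follows, with the scalar -1. *)
Definition submod (op : R -> R -> R) (I : {set R}) : bool :=
  [&& 0 \in I,
      [forall x in I, forall y in I, x + y \in I]
    & [forall a, forall x in I, op a x \in I]].

Definition maximal_lideal (I : {set R}) : bool :=
  maxset (fun J : {set R} => submod lreg J && (J != [set: R])) I.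

Definition jacobson_radical : pred R :=
  fun x => [forall I : {set R}, maximal_lideal I ==> (x \in I)].

Lemma jacobson_zmod_closed : zmod_closed jacobson_radical.
Proof.
split=> [|x y /forallP radx /forallP rady]; apply/forallP => I; apply/implyP.
  by case/maxsetP => /andP[/and3P[]].
move=> maxI; have:= maxI; case/maxsetP => /andP[/and3P[_ addI mulI] _] _.
have Ix := implyP (radx I) maxI; have Iy := implyP (rady I) maxI.
have INy : - y \in I.
  by move/forallP/(_ (-1))/forall_inP/(_ _ Iy): mulI; rewrite /lreg mulN1r.
by move/forall_inP/(_ _ Ix)/forall_inP/(_ _ INy): addI.
Qed.

HB.instance Definition _ := GRing.isZmodClosed.Build R jacobson_radical
  jacobson_zmod_closed.

Definition R_mod_rad := {ideal_quot GRing.ZmodClosed.clone R jacobson_radical _}.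

Definition simple_submod (op : R -> R -> R) (I : {set R}) : bool :=
  minset (fun J : {set R} => submod op J && (J != [set 0])) I.

Definition socle (op : R -> R -> R) : {set R} :=
  [set x | [exists c : {ffun {set R} -> R},
     [forall (I | simple_submod op I), c I \in I]
     && (x == \sum_(I | simple_submod op I) c I)]].

(* R / Rad(R) and Soc(R) are isomorphic as modules for [op]; the scalar action
   on the quotient is a . (x + Rad R) = (op a x) + Rad R. *)
Definition head_iso_socle (op : R -> R -> R) : Prop :=
  exists f : R_mod_rad -> R,
    [/\ injective f,
        {morph f : p q / p + q},
        forall y, y \in socle op <-> exists q, f q = y
      & forall a x, f (\pi_(R_mod_rad)%qT (op a x))
                    = op a (f (\pi_(R_mod_rad)%qT x))].

Definition frobenius : Prop := head_iso_socle rreg /\ head_iso_socle lreg.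

End Frobenius.

Section Characters.
Variables (RR : realType) (R : finUnitRingType).
Implicit Types chi psi : {ffun R -> RR[i]}.

Definition is_character chi : Prop :=
  (forall x, chi x != 0) /\ (forall x y, chi (x + y) = chi x * chi y).

Definition rtwist chi (r : R) : {ffun R -> RR[i]} := [ffun x => chi (r * x)].
Definition ltwist chi (r : R) : {ffun R -> RR[i]} := [ffun x => chi (x * r)].

(* The dual group of R is written multiplicatively; its right (resp. left)
   R-module structure is [rtwist] (resp. [ltwist]). *)
Definition right_generating chi : Prop :=
  [/\ forall r, is_character (rtwist chi r),
      forall r s x, rtwist chi (r + s) x = rtwist chi r x * rtwist chi s x,
      forall r s, rtwist chi (r * s) = rtwist (rtwist chi r) s,
      injective (rtwist chi)
    & forall psi, is_character psi -> exists r, rtwist chi r = psi].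

Definition left_generating chi : Prop :=
  [/\ forall r, is_character (ltwist chi r),
      forall r s x, ltwist chi (r + s) x = ltwist chi r x * ltwist chi s x,
      forall r s, ltwist chi (r * s) = ltwist (ltwist chi s) r,
      injective (ltwist chi)
    & forall psi, is_character psi -> exists r, ltwist chi r = psi].

Definition generating_character chi : Prop :=
  is_character chi /\ (right_generating chi \/ left_generating chi).

End Characters.

Section Codes.
Variables (R : finUnitRingType) (n : nat).
Implicit Types (u v : 'rV[R]_n) (s : 'S_n) (G H : {group 'S_n}).
Implicit Types (C D X : {set 'rV[R]_n}).

Definition vact v s : 'rV[R]_n := \row_i v 0 ((s^-1)%g i).

Definition left_code C : Prop :=
  [/\ 0 \in C, {in C &, forall u v, u + v \in C}
    & forall a, {in C, forall v, a *: v \in C}].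

Definition left_group_code G C : Prop :=
  left_code C /\ {in C & G, forall v s, vact v s \in C}.

Definition theta H v : 'rV[R]_n := (#|H|%:R)^-1 *: \sum_(h in H) vact v h.

Definition theta_set H X : {set 'rV[R]_n} := [set theta H v | v in X].

Definition coord_orbits H : {set {set 'I_n}} :=
  [set orbit 'P%act H j | j in [set: 'I_n]].

Definition orbit_vector (O : {set 'I_n}) : 'rV[R]_n := \row_j (j \in O)%:R.

(* The coefficient u_i of u at the i-th orbit: the common value of u on the
   orbit when u lies in V theta_H, see [orbit_coefP] and [orbit_coef_uniq]. *)
Definition orbit_coef u (O : {set 'I_n}) : R :=
  if [pick j in O] is Some j then u 0 j else 0.

Definition orbit_length_mx H : 'M[R]_n :=
  diag_mx (\row_j #|orbit 'P%act H j|%:R).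

Definition mulM_set H X : {set 'rV[R]_n} :=
  [set y *m orbit_length_mx H | y in X].

Lemma orbit_sum H (c : {set 'I_n} -> R) j :
  (\sum_(O in coord_orbits H) c O *: orbit_vector O) 0 j =
  c (orbit 'P%act H j).
Proof.
have jO : orbit 'P%act H j \in coord_orbits H by apply: imset_f; rewrite inE.
rewrite summxE (bigD1 _ jO) /= big1 => [|O /andP[/imsetP[k _ ->] neO]].
  by rewrite !mxE orbit_refl mulr1 addr0.
rewrite !mxE; case: (boolP (j \in _)) => [jk|]; last by rewrite mulr0.
by case/negP: neO; apply/eqP/esym/orbit_in_eqP; rewrite ?subsetT.
Qed.

Lemma orbit_coefP H u : u \in theta_set H [set: 'rV[R]_n] ->
  u = \sum_(O in coord_orbits H) orbit_coef u O *: orbit_vector O.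
Proof.
case/imsetP => v _ ->; apply/rowP => j; rewrite orbit_sum /orbit_coef.
case: pickP => [k|/(_ j)]; last by rewrite orbit_refl.
case/orbitP => h Hh <-; rewrite !mxE; congr (_ * _); rewrite !summxE.
rewrite [RHS](reindex_inj (mulIg h)) /=; apply: eq_big => [s|s _].
  by rewrite groupMr.
by rewrite !mxE /= /aperm invMg permM permK.
Qed.

Lemma orbit_coef_uniq H u (c : {set 'I_n} -> R) :
  u = \sum_(O in coord_orbits H) c O *: orbit_vector O ->
  {in coord_orbits H, forall O, orbit_coef u O = c O}.
Proof.
move=> -> O /imsetP[j _ ->]; rewrite /orbit_coef.
case: pickP => [k|/(_ j)]; last by rewrite orbit_refl.
by move=> kj; rewrite orbit_sum; congr c; apply/orbit_in_eqP; rewrite ?subsetT.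
Qed.

End Codes.

Definition dotp (R : finUnitRingType) (m : nat) (u v : 'rV[R]_m) : R :=
  \sum_i u 0 i * v 0 i.

Definition right_dual (R : finUnitRingType) (n : nat) (C : {set 'rV[R]_n}) :
  {set 'rV[R]_n} := [set u | [forall v in C, dotp v u == 0]].

Section WeightEnumerator.
Variables (R : finUnitRingType) (n g : nat) (H : {group 'S_n}).

Definition orbit_count (u : {ffun 'I_g -> 'rV[R]_n}) (a : 'rV[R]_g) : nat :=
  #|[set O in coord_orbits H | \row_k orbit_coef (u k) O == a]|.

Definition cwe (A : comNzRingType) (D : {set 'rV[R]_n}) (x : 'rV[R]_g -> A) :
  A :=
  \sum_(u : {ffun 'I_g -> 'rV[R]_n} | [forall k, u k \in D])
    \prod_(a : 'rV[R]_g) x a ^+ orbit_count u a.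

End WeightEnumerator.

(* The indeterminate x_a of the complex polynomial ring with indeterminates
   indexed by R^g. *)
Definition cwe_var (RR : realType) (R : finUnitRingType) (g : nat)
  (a : 'rV[R]_g) : {mpoly RR[i][#|{: 'rV[R]_g}|]} := 'X_(enum_rank a).

(* Main.v *)
(* On H-invariant vectors the coefficients along the orbits O give the pairing
   u . w = sum_O u_O w_O. Since |H| and hence every orbit length is a unit, and
   since (u, y theta) = (u, y) for H-invariant u, the set ((C^perp) theta) M_H is
   exactly the dual of D = C theta for this pairing. Expanding the product over
   the orbits in the right-hand enumerator gives a sum over g-tuples w of
   H-invariant vectors, where the monomial of w has coefficient
   prod_k sum_(u in D) chi (u . w_k); each factor is |D| or 0 according to
   whether w_k lies in the dual, because the kernel of a generating character
   contains no nonzero left ideal. *)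
Require Import Defs.
Set Implicit Arguments.
Unset Strict Implicit.
Unset Printing Implicit Defensive.
Import Order.TTheory GRing.Theory Num.Theory.
Local Open Scope ring_scope.

(** * Vanishing character sums and faithfulness of generating characters *)

Lemma sum_multiplicative_eq0 (K : idomainType) (V : finZmodType) (D : {set V})
    (f : V -> K) (u0 : V) :
  {in D &, forall u v, u + v \in D} -> u0 \in D -> - u0 \in D ->
  {in D &, forall u v, f (u + v) = f u * f v} -> f u0 != 1 ->
  \sum_(u in D) f u = 0.
Proof.
move=> addD Du0 DNu0 fD f_u0.
have shiftD u : (u + u0 \in D) = (u \in D).
  apply/idP/idP => [Du|Du]; last exact: addD.
  by rewrite -(addrK u0 u) addD.
(* Translation by [u0] permutes [D] and multiplies the sum by [f u0]. *)
have: (\sum_(u in D) f u) * (f u0 - 1) = 0.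
  rewrite mulrBr mulr1 mulr_suml [X in _ - X](reindex_inj (addIr u0)) /=.
  under [X in _ - X]eq_bigl do rewrite shiftD.
  by rewrite -sumrB big1 // => u Du; rewrite fD // subrr.
by move/eqP; rewrite mulf_eq0 subr_eq0 (negPf f_u0) orbF => /eqP.
Qed.

Section Characters.
Variables (RR : realType) (R : finUnitRingType) (chi : {ffun R -> RR[i]}).

Lemma character0 : is_character chi -> chi 0 = 1.
Proof.
case=> chi_neq0 chiD; apply: (mulfI (chi_neq0 0)).
by rewrite -chiD addr0 mulr1.
Qed.

Lemma character_sum (I : Type) (r : seq I) (P : pred I) (F : I -> R) :
  is_character chi ->
  chi (\sum_(i <- r | P i) F i) = \prod_(i <- r | P i) chi (F i).
Proof.
move=> chi_char; apply: (big_morph chi _ (character0 chi_char)).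
by case: chi_char.
Qed.

(* For a right generating character, the matrix [chi (s * x)] has orthogonal
   rows because the twists of [chi] are distinct characters; being square, it
   then has orthogonal columns too, so the column of [r] differs from that of
   [0] unless [r = 0]. *)
Lemma generating_character_faithful :
  generating_character chi ->
  forall r, (forall x, chi (x * r) = 1) -> r = 0.
Proof.
case=> chi_char gen r chi_r1.
have chi0 := character0 chi_char; have [_ chiD] := chi_char.
(* The left generating case is immediate: the left twists by [r] and [0] coincide. *)
case: gen => -[_ _ _ inj_twist _]; last first.
  by apply: inj_twist; apply/ffunP => x; rewrite !ffunE chi_r1 mulr0 chi0.
have row_sum s : s != 0 -> \sum_x chi (s * x) = 0.
  move=> s_neq0; have [x chi_sx]: exists x, chi (s * x) != 1.
    apply/existsP; apply: contraR s_neq0; rewrite negb_exists => /forallP chi1.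
    apply/eqP/inj_twist/ffunP => x; rewrite !ffunE mul0r chi0.
    exact/eqP/negbNE.
  have := @sum_multiplicative_eq0 _ _ [set: R] (fun x => chi (s * x)) x.
  rewrite (eq_bigl xpredT) => [|y]; last by rewrite inE.
  apply=> //; rewrite ?inE // => u v _ _; last by rewrite mulrDr chiD.
  by rewrite inE.
pose N := #|R|; pose c : RR[i] := N%:R.
have c_neq0 : c != 0 by rewrite pnatr_eq0 -lt0n; apply/card_gt0P; exists 0.
pose A := \matrix_(i < N, j < N) chi (enum_val i * enum_val j).
(* Since [chi (- x)] inverts [chi x], row orthogonality makes [B] a right inverse of [A]. *)
pose B := \matrix_(i < N, j < N) (c^-1 * chi (- (enum_val j * enum_val i))).
have AB1 : A *m B = 1%:M.
  apply/matrixP => i j; rewrite !mxE.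
  have -> : \sum_k A i k * B k j =
            c^-1 * \sum_x chi ((enum_val i - enum_val j) * x).
    rewrite mulr_sumr [RHS](reindex_onto enum_val enum_rank) /=; last first.
      by move=> x _; rewrite enum_rankK.
    apply: eq_big => [k|k _]; first by rewrite enum_valK eqxx.
    by rewrite !mxE mulrCA -chiD mulrBl.
  have [->|neq_ij] := eqVneq i j.
    under eq_bigr do rewrite subrr mul0r chi0.
    by rewrite sumr_const -[#|_|%:R]/c mulVf.
  rewrite row_sum ?mulr0 // subr_eq0; apply: contra neq_ij.
  by move=> /eqP/enum_val_inj->.
apply/eqP; apply: contraT => r_neq0.
(* This entry of [B *m A] is off the diagonal, yet each of its [N] summands equals [c^-1]. *)
have /matrixP/(_ (enum_rank 0) (enum_rank r)) := mulmx1C AB1.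
rewrite !mxE [_ == _](_ : _ = false); last first.
  by apply/negP => /eqP/enum_rank_inj/esym/eqP; rewrite (negPf r_neq0).
under eq_bigr do rewrite !mxE !enum_rankK mulr0 oppr0 chi0 chi_r1 !mulr1.
rewrite sumr_const card_ord -mulr_natr mulVf // => /eqP.
by rewrite oner_eq0.
Qed.

End Characters.

(** * Orbit-invariant vectors, averaging and the orbit pairing *)

Section Orbits.
Variables (R : finUnitRingType) (n : nat) (H : {group 'S_n}).
Implicit Types (u v w : 'rV[R]_n) (O : {set 'I_n}) (C D : {set 'rV[R]_n}).

Local Notation orb j := (orbit 'P%act H j).
Local Notation E := (coord_orbits H).

Lemma orbit_coefD u v O :
  orbit_coef (u + v) O = orbit_coef u O + orbit_coef v O.
Proof. by rewrite /orbit_coef; case: pickP => *; rewrite ?mxE ?addr0. Qed.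

Lemma orbit_coefZ a u O : orbit_coef (a *: u) O = a * orbit_coef u O.
Proof. by rewrite /orbit_coef; case: pickP => *; rewrite ?mxE ?mulr0. Qed.

Lemma orbit_eqE j k : (orb j == orb k) = (j \in orb k).
Proof. by apply/eqP/orbit_in_eqP; rewrite ?subsetT. Qed.

Lemma mem_coord_orbits j : orb j \in E.
Proof. by apply: imset_f; rewrite inE. Qed.

(** These are the vectors constant on each orbit; they form the image of [theta H] once [#|H|] is a
    unit. *)
Definition orbit_invariant : {set 'rV[R]_n} :=
  [set u : 'rV[R]_n | [forall j, u 0 j == orbit_coef u (orb j)]].

Lemma orbit_invariantP u :
  reflect (forall j, u 0 j = orbit_coef u (orb j)) (u \in orbit_invariant).
Proof. by rewrite inE; apply: (iffP forallP) => uE j; apply/eqP. Qed.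

Definition orbit_row (c : {set 'I_n} -> R) : 'rV[R]_n := \row_j c (orb j).

Lemma orbit_coef_row c O : O \in E -> orbit_coef (orbit_row c) O = c O.
Proof.
case/imsetP => j _ ->; rewrite /orbit_coef.
case: pickP => [k|/(_ j)]; last by rewrite orbit_refl.
by rewrite mxE -orbit_eqE => /eqP->.
Qed.

Lemma orbit_row_invariant c : orbit_row c \in orbit_invariant.
Proof.
by apply/orbit_invariantP => j; rewrite orbit_coef_row ?mem_coord_orbits ?mxE.
Qed.

Lemma orbit_row_coef u c : u \in orbit_invariant ->
  {in E, forall O, c O = orbit_coef u O} -> orbit_row c = u.
Proof.
move/orbit_invariantP => uE cE; apply/rowP => j.
by rewrite mxE uE cE ?mem_coord_orbits.
Qed.

Lemma theta_invariant v : theta H v \in orbit_invariant.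
Proof.
apply/orbit_invariantP => j.
have /orbit_coefP/rowP/(_ j) : theta H v \in theta_set H [set: 'rV_n].
  by apply: imset_f; rewrite inE.
by rewrite orbit_sum.
Qed.

Lemma vact_invariant u h : u \in orbit_invariant -> h \in H -> vact u h = u.
Proof.
move=> /orbit_invariantP uE Hh; apply/rowP => j; rewrite mxE !uE.
congr orbit_coef; apply/eqP; rewrite orbit_eqE.
by rewrite -[_ j]/('P%act j h^-1%g) mem_orbit ?groupV.
Qed.

Lemma dotpDl u v w : dotp (u + v) w = dotp u w + dotp v w.
Proof.
by rewrite /dotp -big_split; apply: eq_bigr => i _; rewrite mxE mulrDl.
Qed.

Lemma dotpZl a u v : dotp (a *: u) v = a * dotp u v.
Proof.
by rewrite /dotp mulr_sumr; apply: eq_bigr => i _; rewrite mxE mulrA.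
Qed.

Lemma dotp_suml (I : Type) (r : seq I) (P : pred I) (F : I -> 'rV[R]_n) v :
  dotp (\sum_(i <- r | P i) F i) v = \sum_(i <- r | P i) dotp (F i) v.
Proof.
apply: (big_morph (fun u => dotp u v)) => [u w|]; first exact: dotpDl.
by rewrite -[0](scale0r 0) dotpZl mul0r.
Qed.

Lemma dotp_sumr (I : Type) (r : seq I) (P : pred I) (F : I -> 'rV[R]_n) u :
  dotp u (\sum_(i <- r | P i) F i) = \sum_(i <- r | P i) dotp u (F i).
Proof.
rewrite /dotp exchange_big; apply: eq_bigr => i _.
by rewrite summxE mulr_sumr.
Qed.

(** [R] may be noncommutative, so only central scalars leave the right slot; the one needed is the
    inverse of [#|H|]. *)
Lemma dotpZr_central a u v : (forall x, GRing.comm x a) ->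
  dotp u (a *: v) = a * dotp u v.
Proof.
move=> ac; rewrite /dotp mulr_sumr; apply: eq_bigr => i _.
by rewrite mxE !mulrA ac.
Qed.

Lemma dotp_vact u v s : dotp (vact u s) (vact v s) = dotp u v.
Proof.
rewrite /dotp (reindex_inj (@perm_inj _ s)); apply: eq_bigr => i _.
by rewrite !mxE permK.
Qed.

(** An orbit contributes [#|O|] equal terms; [orbit_length_mx] absorbs this factor into [v], which
    turns [dotp] into [orbit_dot]. *)
Lemma dotp_orbits u v :
  u \in orbit_invariant -> v \in orbit_invariant ->
  dotp u v = \sum_(O in E) orbit_coef u O * (orbit_coef v O * #|O|%:R).
Proof.
move=> /orbit_invariantP uE /orbit_invariantP vE; rewrite /dotp.
rewrite (partition_big (fun j => orb j) (mem E)) => [|j _]; last first.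
  exact: mem_coord_orbits.
apply: eq_bigr => O /imsetP[k _ ->].
under eq_bigl do rewrite orbit_eqE.
rewrite (eq_bigr (fun=> orbit_coef u (orb k) * orbit_coef v (orb k))).
  by rewrite sumr_const mulrA mulr_natr.
by move=> j; rewrite -orbit_eqE uE vE => /eqP->.
Qed.

Definition orbit_dot u v : R := \sum_(O in E) orbit_coef u O * orbit_coef v O.

Definition orbit_dual D : {set 'rV[R]_n} :=
  [set w in orbit_invariant | [forall u in D, orbit_dot u w == 0]].

Lemma orbit_dotDl u v w : orbit_dot (u + v) w = orbit_dot u w + orbit_dot v w.
Proof.
by rewrite -big_split; apply: eq_bigr => O _; rewrite orbit_coefD mulrDl.
Qed.

Lemma orbit_dotZl a u v : orbit_dot (a *: u) v = a * orbit_dot u v.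
Proof.
by rewrite mulr_sumr; apply: eq_bigr => O _; rewrite orbit_coefZ mulrA.
Qed.

Lemma mulmx_orbit_length u j :
  (u *m orbit_length_mx R H) 0 j = u 0 j * #|orb j|%:R.
Proof. by rewrite mul_mx_diag !mxE. Qed.

Lemma orbit_coef_mul_length u O : O \in E ->
  orbit_coef (u *m orbit_length_mx R H) O = orbit_coef u O * #|O|%:R.
Proof.
case/imsetP => j _ ->; rewrite /orbit_coef.
case: pickP => [k|_]; last by rewrite mul0r.
by rewrite -orbit_eqE mulmx_orbit_length => /eqP->.
Qed.

Lemma theta_left_code C : left_code C -> left_code (theta_set H C).
Proof.
case=> C0 CD CZ.
have thetaD u v : theta H (u + v) = theta H u + theta H v.
  rewrite /theta -scalerDr -big_split; congr (_ *: _); apply: eq_bigr => h _.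
  by apply/rowP => j; rewrite !mxE.
have thetaZ a u : theta H (a *: u) = a *: theta H u.
  rewrite /theta scalerA (commrV (commr_nat a _)) -scalerA.
  rewrite [X in _ = _ *: X]scaler_sumr.
  congr (_ *: _); apply: eq_bigr => h _; apply/rowP => j.
  by rewrite !mxE.
split=> [|_ _ /imsetP[u Cu ->] /imsetP[v Cv ->]|a _ /imsetP[u Cu ->]].
- by apply/imsetP; exists 0 => //; rewrite -(scale0r 0) thetaZ !scale0r.
- by rewrite -thetaD imset_f // CD.
- by rewrite -thetaZ imset_f // CZ.
Qed.

Hypothesis H_unit : (#|H|%:R : R) \is a GRing.unit.

Lemma theta_id u : u \in orbit_invariant -> theta H u = u.
Proof.
move=> uH; rewrite /theta (eq_bigr (fun=> u)) => [|h]; last first.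
  exact: vact_invariant.
by rewrite sumr_const -scaler_nat scalerA mulVr // scale1r.
Qed.

(** [dotp] is unchanged when both arguments are permuted, and [v] is fixed by [H], so all terms of
    the average agree. *)
Lemma dotp_thetal u v : v \in orbit_invariant -> dotp (theta H u) v = dotp u v.
Proof.
move=> vH; rewrite dotpZl dotp_suml (eq_bigr (fun=> dotp u v)) => [|h Hh].
  by rewrite sumr_const -[X in _ * X]mulr_natl mulKr.
by rewrite -{1}(vact_invariant vH Hh) dotp_vact.
Qed.

Lemma dotp_thetar u v : u \in orbit_invariant -> dotp u (theta H v) = dotp u v.
Proof.
move=> uH; rewrite dotpZr_central => [|x]; last exact/commrV/commr_nat.
rewrite dotp_sumr (eq_bigr (fun=> dotp u v)) => [|h Hh].
  by rewrite sumr_const -[X in _ * X]mulr_natl mulKr.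
by rewrite -{1}(vact_invariant uH Hh) dotp_vact.
Qed.

(** Orbit lengths divide [#|H|], and commuting factors of a unit are units. *)
Lemma card_orbit_unit O : O \in E -> (#|O|%:R : R) \is a GRing.unit.
Proof.
case/imsetP => j _ ->; have /dvdnP[q Hq] := dvdn_orbit 'P%act H j.
move: H_unit; rewrite Hq natrM unitrM_comm; first by case/andP.
exact/commr_nat.
Qed.

Lemma theta_dual_orbit_length C :
  left_code C -> {in C & H, forall v s, vact v s \in C} ->
  mulM_set H (theta_set H (right_dual C)) = orbit_dual (theta_set H C).
Proof.
case=> C0 CD CZ CH; apply/setP => w; apply/idP/idP.
  case/imsetP => _ /imsetP[v Cv ->] ->.
  have thH := theta_invariant v; rewrite inE; apply/andP; split.
    apply/orbit_invariantP => j.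
    rewrite mulmx_orbit_length orbit_coef_mul_length ?mem_coord_orbits //.
    by rewrite (orbit_invariantP _ thH).
  apply/forall_inP => u Du; have uH : u \in orbit_invariant.
    by case/imsetP: Du => c _ ->; apply: theta_invariant.
  (* Averaging over [H] stays inside [C], so [v] in the dual of [C] already annihilates [u]. *)
  have Cu : u \in C.
    case/imsetP: Du => c Cc ->; apply: CZ.
    by apply: (big_ind (fun x => x \in C)) => // h Hh; apply: CH.
  have -> : orbit_dot u (theta H v *m orbit_length_mx R H) = dotp u (theta H v).
    rewrite dotp_orbits //; apply: eq_bigr => O EO.
    by rewrite orbit_coef_mul_length.
  by rewrite dotp_thetar //; move: Cv; rewrite inE => /forall_inP->.
rewrite inE => /andP[wH /forall_inP wD].
(* Dividing by the orbit lengths inverts [orbit_length_mx]; [y] is invariant, hence its own average,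
   and only its duality to [C] remains. *)
pose y := orbit_row (fun O => orbit_coef w O / #|O|%:R).
have yH : y \in orbit_invariant := orbit_row_invariant _.
have yw : y *m orbit_length_mx R H = w.
  apply/rowP => j; rewrite mulmx_orbit_length mxE divrK.
    by rewrite (orbit_invariantP _ wH).
  exact/card_orbit_unit/mem_coord_orbits.
rewrite -yw; apply: imset_f; rewrite -(theta_id yH); apply: imset_f.
rewrite inE; apply/forall_inP => c Cc.
rewrite -dotp_thetal // dotp_orbits ?theta_invariant //.
have := wD _ (imset_f (theta H) Cc); rewrite -yw.
congr (_ == 0); apply: eq_bigr => O EO.
by rewrite orbit_coef_mul_length.
Qed.

End Orbits.

(** * The MacWilliams identity for the orbit pairing *)

Section MacWilliams.
Variables (RR : realType) (R : finUnitRingType) (chi : {ffun R -> RR[i]}).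
Variables (n g : nat) (H : {group 'S_n}).

Local Notation E := (coord_orbits H).

(** Grouping orbits by their label recovers the exponents; a product over orbits is the form that
    distributivity can expand. *)
Lemma cweE (A : comNzRingType) (D : {set 'rV[R]_n}) (x : 'rV[R]_g -> A) :
  cwe H D x =
  \sum_(u : {ffun 'I_g -> 'rV[R]_n} | [forall k, u k \in D])
    \prod_(O in E) x (\row_k orbit_coef (u k) O).
Proof.
apply: eq_bigr => u _.
rewrite [RHS](partition_big (fun O => \row_k orbit_coef (u k) O) xpredT) //=.
apply: eq_bigr => a _; rewrite (eq_bigr (fun=> x a)) => [|O /andP[_ /eqP->]] //.
by rewrite prodr_const /orbit_count cardsE.
Qed.

Hypothesis chi_gen : generating_character chi.

(* The character [u |-> chi (u . w)] of D is trivial iff the left ideal of all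
   [u . w] lies in the kernel of [chi], that is, iff that ideal is zero. *)
Lemma character_orbit_sum (D : {set 'rV[R]_n}) (w : 'rV[R]_n) :
  left_code D -> w \in orbit_invariant R H ->
  \sum_(u in D) chi (orbit_dot H u w) =
  if w \in orbit_dual H D then #|D|%:R else 0.
Proof.
case=> D0 DD DZ wH; have [chi_char _] := chi_gen.
rewrite inE wH /=; case: ifPn => [/forall_inP uw0|].
  rewrite (eq_bigr (fun=> 1)) ?sumr_const // => u Du.
  by rewrite (eqP (uw0 u Du)) character0.
rewrite negb_forall_in => /exists_inP[v Dv vw_neq0].
have [a chi_a]: exists a, chi (a * orbit_dot H v w) != 1.
  apply/existsP; apply: contraR vw_neq0; rewrite negb_exists => /forallP chi1.
  apply/eqP/(generating_character_faithful chi_gen) => a.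
  exact/eqP/negbNE.
apply: (@sum_multiplicative_eq0 _ _ _ _ (a *: v)) => //.
- exact: DZ.
- by rewrite -scaleNr; apply: DZ.
- by move=> u1 u2 _ _; rewrite orbit_dotDl; case: chi_char.
- by rewrite orbit_dotZl.
Qed.

Lemma cwe_orbit_dual (A : comAlgType RR[i]) (D : {set 'rV[R]_n})
    (x : 'rV[R]_g -> A) :
  left_code D ->
  cwe H D (fun a => \sum_b chi (dotp a b) *: x b) =
  #|D|%:R ^+ g *: cwe H (orbit_dual H D) x.
Proof.
move=> codeD; have [chi_char _] := chi_gen.
rewrite !cweE.
pose vec (f : {ffun {set 'I_n} -> 'rV[R]_g}) k :=
  orbit_row H (fun O => f O 0 k).
have colH f k : vec f k \in orbit_invariant R H := orbit_row_invariant H _.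
(* The expansion runs over labellings [f] of the orbits by R^g, with default value [0] outside
   [E]. *)
under eq_bigr do rewrite (big_distr_big_dep 0).
rewrite exchange_big /=.
pose to_orbits (w : {ffun 'I_g -> 'rV[R]_n}) : {ffun {set 'I_n} -> 'rV[R]_g} :=
  [ffun O => if O \in E then \row_k orbit_coef (w k) O else 0].
rewrite [X in _ *: X](reindex_onto (fun f => [ffun k => vec f k]) to_orbits) /=;
  last first.
  move=> w /forallP wD; apply/ffunP => k; rewrite ffunE.
  have: w k \in orbit_invariant R H by have:= wD k; rewrite inE => /andP[].
  by move=> wkH; apply: orbit_row_coef => // O EO; rewrite ffunE EO mxE.
have rowE f O : O \in E -> \row_k orbit_coef (vec f k) O = f O.
  by move=> EO; apply/rowP => k; rewrite mxE orbit_coef_row.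
(* Labellings vanishing off [E] are exactly those recovered from their vectors [vec f k], so both
   sums have the same index set. *)
have suppE (f : {ffun {set 'I_n} -> 'rV[R]_g}) :
    (f \in pfamily 0 (mem E) (fun=> xpredT)) =
    (to_orbits [ffun k => vec f k] == f).
  apply/pfamilyP/eqP => [[/subsetP suppf _]|<-].
    apply/ffunP => O; rewrite ffunE; case: ifPn => [EO|notEO].
      by under eq_mx do rewrite ffunE; rewrite rowE.
    by apply/esym/eqP; apply: contraNT notEO => /suppf.
  split=> //; apply/subsetP => O; rewrite inE ffunE; case: ifP => //.
  by rewrite eqxx.
under [in RHS]eq_bigl do rewrite -suppE andbC.
(* Membership in the dual becomes a conditional, so the sides can be compared for each [f]. *)
rewrite [in RHS]big_mkcondr scaler_sumr /=; apply: eq_bigr => f _.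
(* As [chi] turns sums into products, the sum over tuples [u] splits into one character sum for each
   [k]. *)
transitivity ((\prod_(k < g) \sum_(u in D) chi (orbit_dot H u (vec f k))) *:
              \prod_(O in E) x (f O)).
  rewrite bigA_distr_big scaler_suml; apply: eq_big => [u|u _].
    by apply/forallP/ffun_onP; apply.
  rewrite scaler_prod; congr (_ *: _).
  rewrite -(character_sum _ _ _ chi_char) /dotp exchange_big /=.
  rewrite character_sum //; apply: eq_bigr => k _.
  congr (chi _); apply: eq_bigr => O EO.
  by rewrite !mxE orbit_coef_row.
rewrite (eq_bigr _ (fun k _ => character_orbit_sum codeD (colH f k))) /=.
case: ifPn => [/forallP dual|].
  rewrite (eq_bigr (fun=> #|D|%:R)) => [|k _]; last first.
    by have:= dual k; rewrite ffunE => ->.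
  rewrite prodr_const card_ord; congr (_ *: _); apply: eq_bigr => O EO.
  by under eq_mx do rewrite ffunE; rewrite rowE.
rewrite negb_forall scaler0 => /existsP[k]; rewrite ffunE => /negPf notdual.
by rewrite (bigD1 k) //= notdual mul0r scale0r.
Qed.

End MacWilliams.

Theorem theorem3p5 (RR : realType) (R : finUnitRingType)
    (chi : {ffun R -> RR[i]}) (n g : nat) (G H : {group 'S_n})
    (C : {set 'rV[R]_n}) :
  frobenius R ->
  generating_character chi ->
  (1 <= g)%N ->
  H \subset G ->
  (#|H|%:R : R) \is a GRing.unit ->
  left_group_code G C ->
  cwe H (mulM_set H (theta_set H (right_dual C))) (@cwe_var RR R g) =
  (#|theta_set H C|%:R ^+ g)^-1 *:
    cwe H (theta_set H C)
      (fun a : 'rV[R]_g =>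
         \sum_(b : 'rV[R]_g) chi (dotp a b) *: @cwe_var RR R g b).
Proof.
move=> _ chi_gen _ /subsetP sHG H_unit [codeC CG].
have codeD := theta_left_code H codeC.
rewrite (cwe_orbit_dual H chi_gen) // theta_dual_orbit_length //; last first.
  by move=> v s Cv Hs; apply: CG => //; apply: sHG.
(* The averaged code contains [0], so its cardinality is nonzero in the complex field. *)
rewrite scalerA mulVf ?scale1r // expf_neq0 // pnatr_eq0 -lt0n.
by apply/card_gt0P; exists 0; case: codeD.
Qed.
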